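(* Let $(X,f)$ be a topological dynamical system satisfying the non-uniform $\tau$-specification property, and assume that $f$ is positively expansive. If $\tau<\infty$, then for every $0\le\gamma<h_{top}(f)$ and every $\beta$ with $$\frac{\tau}{1+\tau}h_{top}(f)<\beta<h_{top}(f)-\gamma$$ there is a closed $f$-invariant set $Y\subset X$ such that $$\gamma<h_{top}(f|_Y)<\gamma+\beta.$$
   Context: A topological dynamical system $(X,f)$ consists of a compact metric space $(X,d)$ with at least two points and a continuous map $f:X\to X$; $h_{top}$ is topological entropy. $f$ is positively expansive if there is $\varepsilon_0>0$ such that $x\ne y$ implies $d(f^ix,f^iy)\ge\varepsilon_0$ for some integer $i\ge0$. A set $Y$ is $f$-invariant if $f(Y)\subset Y$. Non-uniform specification: $(X,f)$ has the non-uniform specification property with gap function $M:\mathbb{N}\times(0,\infty)\to\mathbb{N}$ ($\mathbb{N}$ the positive integers) if $M(n,\varepsilon)$ is non-decreasing in $n$ and non-increasing in $\varepsilon$, and for every $\varepsilon>0$, every integer $k\ge2$, all $x_1,\dots,x_k\in X$ and all non-negative integers $a_1\le b_1<a_2\le b_2<\cdots<a_k\le b_k$ with $a_{i+1}-b_i\ge M(b_i-a_i+1,\varepsilon)$ for $1\le i\le k-1$, there is $z\in X$ with $d(f^{n-a_i}x_i,f^nz)\le\varepsilon$ for all $a_i\le n\le b_i$, $1\le i\le k$. Let $\mathscr{G}(X,f)$ be the set of all such gap functions for $(X,f)$ and $\tau(M)=\sup_{\varepsilon>0}\liminf_{n\to\infty}M(n,\varepsilon)/n\in[0,\infty]$.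 $(X,f)$ has the non-uniform $\tau$-specification property if there is $M\in\mathscr{G}(X,f)$ with $\tau(M)=\tau$ and every $M'\in\mathscr{G}(X,f)$ satisfies $\tau(M')\ge\tau$. *)

(* Defs.v *)
From HB Require Import structures.
From mathcomp Require Import all_boot all_order all_algebra finmap.
From mathcomp Require Import all_classical all_reals all_analysis.

Set Implicit Arguments.
Unset Strict Implicit.
Unset Printing Implicit Defensive.

Import Order.TTheory GRing.Theory Num.Theory.
Import numFieldNormedType.Exports.

Local Open Scope classical_set_scope.
Local Open Scope ring_scope.

Section entropy.
Context {R : realType} {X : metricType R}.
Implicit Types (f : X -> X) (Y E : set X).

Definition invariant_set f Y := f @` Y `<=` Y.

Definition separated f (n : nat) (eps : R) E :=
  forall x y, E x -> E y -> x <> y ->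
    exists2 i, (i < n)%N & eps < mdist (iter i f x) (iter i f y).

(* Maximal cardinality of an (n, eps)-separated subset of Y.  The supremum is
   over finite subsets; if there are arbitrarily large ones it is +oo, which
   does not happen when X is compact, f is continuous and eps > 0. *)
Definition max_separated f Y (n : nat) (eps : R) : \bar R :=
  ereal_sup [set (#|` E|%:R)%:E
            | E in [set E : {fset X} | [set` E] `<=` Y /\
                                       separated f n eps [set` E]]].

(* Bowen's definition of the topological entropy of f restricted to an
   invariant set Y.  The inner limsup increases as eps decreases, so that the
   supremum over eps > 0 is the limit as eps goes to 0. *)
Definition entropy_on f Y : \bar R :=
  ereal_sup [set limn_esup (fun n => (n%:R^-1)%:E *
                                     lne (max_separated f Y n eps))%E
            | eps in [set eps : R | 0 < eps]].

Definition top_entropy f : \bar R := entropy_on f setT.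

Definition positively_expansive f :=
  exists2 eps0 : R, 0 < eps0 &
    forall x y : X, x <> y ->
      exists i : nat, eps0 <= mdist (iter i f x) (iter i f y).

End entropy.

Section specification.
Context {R : realType} {X : metricType R}.
Implicit Types (f : X -> X) (M : nat -> R -> nat).

(* A function from {1, 2, ...} x (0, +oo) to {1, 2, ...} is represented by a
   total M : nat -> R -> nat; the values M 0 eps, and M n eps for eps <= 0, are
   unconstrained and play no role. *)
Record gap_monotone M : Prop := {
  gap_gt0 : forall n eps, (0 < n)%N -> 0 < eps -> (0 < M n eps)%N ;
  gap_nondecreasing : forall m n eps, (0 < m)%N -> (m <= n)%N -> 0 < eps ->
    (M m eps <= M n eps)%N ;
  gap_nonincreasing : forall n eps eps', (0 < n)%N -> 0 < eps -> eps <= eps' ->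
    (M n eps' <= M n eps)%N }.

(* The orbit segments are indexed by i < k; the values of x, a, b at indices
   i >= k play no role. *)
Definition gap_tracing f M :=
  forall (eps : R) (k : nat) (x : nat -> X) (a b : nat -> nat),
    0 < eps -> (2 <= k)%N ->
    (forall i, (i < k)%N -> (a i <= b i)%N) ->
    (forall i, (i.+1 < k)%N -> (b i < a i.+1)%N) ->
    (forall i, (i.+1 < k)%N ->
       (M (b i - a i + 1) eps <= a i.+1 - b i)%N) ->
    exists z : X, forall i n, (i < k)%N -> (a i <= n <= b i)%N ->
      mdist (iter (n - a i) f (x i)) (iter n f z) <= eps.

Definition gap_functions f : set (nat -> R -> nat) :=
  [set M | gap_monotone M /\ gap_tracing f M].

Definition gap_rate M : \bar R :=
  ereal_sup [set limn_einf (fun n => ((M n eps)%:R / n%:R : R)%:E)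
            | eps in [set eps : R | 0 < eps]].

Definition nonuniform_specification f (tau : \bar R) :=
  (exists2 M, gap_functions f M & gap_rate M = tau) /\
  (forall M', gap_functions f M' -> (tau <= gap_rate M')%E).

End specification.

(* Main.v *)
(* Write h for the topological entropy.  Take an (n, 3 e)-separated set E of
   about exp(gamma (n + g)) points, where g = M(n, e) and n is chosen with
   g <= (tau + d) n, and let Y be the closed set of orbits which, after a shift
   by less than n + g, e-shadow in each window of length n + g some orbit segment
   of length n starting in E, and are unconstrained for the remaining time g.
   Specification makes every sequence of points of E occur, so the entropy of Y
   is at least ln |E| / (n + g).  By expansiveness the entropy of Y can be
   computed at one fixed scale, at which the free gaps contribute at most
   g (h + d) / (n + g), which is about tau / (1 + tau) h.  A set E of the right
   size exists because gamma (1 + tau) < h. *)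
From mathcomp Require Import all_boot all_order all_algebra finmap.
From mathcomp Require Import all_classical all_reals all_analysis.
From mathcomp Require Import ring lra zify.
(* Imported last, so that [separated] is the one of Defs. *)
Require Import Defs.

Set Implicit Arguments.
Unset Strict Implicit.
Unset Printing Implicit Defensive.

Import Order.TTheory GRing.Theory Num.Theory.
Import numFieldNormedType.Exports.

Local Open Scope classical_set_scope.
Local Open Scope ring_scope.

(** * Upper and lower limits of sequences *)

Section limits.
Context {R : realType}.
Implicit Types (u : nat -> \bar R) (a : \bar R).

Lemma limn_esup_le u a n0 :
  (forall n, (n0 <= n)%N -> (u n <= a)%E) -> (limn_esup u <= a)%E.
Proof.
move=> ua; apply: (@le_trans _ _ (ereal_sup (u @` [set n | (n0 <= n)%N]))).
  apply: ereal_inf_lbound; exists [set n | (n0 <= n)%N] => //.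
  exact: nbhs_infty_ge.
by apply: ge_ereal_sup => _ [n n0n <-]; exact: ua.
Qed.

Lemma limn_esup_ge u a :
  (forall n0, exists2 n, (n0 <= n)%N & (a <= u n)%E) -> (a <= limn_esup u)%E.
Proof.
move=> ua; apply: le_ereal_inf_tmp => _ [V [n0 _ n0V] <-].
have [n n0n an] := ua n0.
by apply: (le_trans an); apply: ereal_sup_ubound; exists n => //; exact: n0V.
Qed.

Lemma limn_esup_lt u a : (limn_esup u < a)%E ->
  exists n0, forall n, (n0 <= n)%N -> (u n < a)%E.
Proof.
move=> ua; apply: contrapT => /forallNP H.
suff : (a <= limn_esup u)%E by rewrite leNgt ua.
apply: limn_esup_ge => n0; have /existsNP[n /not_implyP[n0n]] := H n0.
by move=> /negP; rewrite -leNgt; exists n.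
Qed.

Lemma limn_einf_lt u a : (limn_einf u < a)%E ->
  forall n0, exists2 n, (n0 <= n)%N & (u n < a)%E.
Proof.
move=> ua n0; apply: contrapT => H.
suff : (a <= limn_einf u)%E by rewrite leNgt ua.
rewrite /limn_einf leeNr; apply: (@limn_esup_le _ _ n0) => n n0n.
by rewrite leeN2 leNgt; apply/negP => una; apply: H; exists n.
Qed.

End limits.

(** * Compactness and continuity in metric spaces *)

Section metric.
Context {R : realType} {X : metricType R}.

Lemma nbhs_mdist_lt (x : X) (e : R) : 0 < e -> nbhs x [set y | mdist x y < e].
Proof. by rewrite -ballEmdist; exact: nbhsx_ballx. Qed.

Lemma closed_mdist_le (T : topologicalType) (g h : T -> X) (e : R) :
  continuous g -> continuous h -> closed [set t | mdist (g t) (h t) <= e].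
Proof.
move=> gc hc p clp /=; apply/ler_addgt0Pr => d d0.
have d20 : 0 < d / 2 by rewrite divr_gt0.
have gp : nbhs p [set t | mdist (g p) (g t) < d / 2].
  exact: (gc p _ (nbhs_mdist_lt (g p) d20)).
have hp : nbhs p [set t | mdist (h p) (h t) < d / 2].
  exact: (hc p _ (nbhs_mdist_lt (h p) d20)).
have [t [/= le_e [/= tg th]]] := clp _ (filterI gp hp).
have := metric_triangle (g p) (g t) (h p).
have := metric_triangle (g t) (h t) (h p).
by rewrite (metric_sym (h t)); lra.
Qed.

Lemma mdist_le_add (x y z : X) (e d : R) :
  mdist x y <= e -> mdist x z <= d -> mdist y z <= e + d.
Proof.
move=> xy xz; have := metric_triangle y x z; rewrite (metric_sym y x); lra.
Qed.

(** Any cluster point works. The point [p] comes before the closed set [A], so that infinitely many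
    closed conditions, each holding from some index on, pass to the same [p]. *)
Lemma compact_seq_cluster (T : topologicalType) (z : nat -> T) :
  compact [set: T] -> exists p, forall A : set T, closed A ->
    (forall n0, (forall n, (n0 <= n)%N -> A (z n)) -> A p).
Proof.
move=> Tc; have [p [_ clp]] := Tc (z @ \oo) _ filterT.
exists p => A Acl n0 zA.
have: cluster (z @ \oo) p by [].
rewrite clusterE => /(_ A).
rewrite -(closure_id A).1//; apply.
by exists n0.
Qed.

Lemma compact_finite_net (e : R) : compact [set: X] -> 0 < e ->
  exists D : {fset X}, forall x, exists2 y, y \in D & mdist y x < e.
Proof.
move=> /compact_near_coveringP Xc e0.
(* [F] is the filter of finite sets growing under inclusion; near each [x] every set containing [x]
   is a net, and compactness makes one set serve all points. *)
pose F : set_system {fset X} :=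
  filter_from setT (fun D => [set D' | D `<=` D']%fset).
have FF : Filter F.
  apply: filter_from_filter; first by exists fset0.
  move=> A B _ _; exists (A `|` B)%fset => // D /=.
  by rewrite fsubUset => /andP[].
have := Xc _ F (fun (D : {fset X}) x => exists2 y, y \in D & mdist y x < e) FF.
move=> /(_ _)[]//.
  move=> x _; exists ([set y | mdist x y < e], [set D | [fset x] `<=` D]%fset).
    split => /=; last by exists [fset x]%fset.
    exact: nbhs_mdist_lt.
  by move=> [y D]/= [xy xD]; exists x => //; rewrite fsub1set in xD.
by move=> D _ /(_ D (fsubset_refl _)) H; exists D => x; exact: H.
Qed.

Lemma continuous_iter (f : X -> X) n : continuous f -> continuous (iter n f).
Proof.
move=> fc; elim: n => [|n IH] x; first exact: cvg_id.
exact: (continuous_comp (IH x) (fc _)).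
Qed.

End metric.

(** * Finite codes and separated sets *)

Section codes.
Context {R : realType} {X : metricType R}.
Implicit Types (f : X -> X) (Y : set X) (T : finType).

(** A cover of [Y] by [#|T|] sets of diameter at most [eta] in the [n]-step metric. Labels in a
    finite type let codes be combined by products and function spaces, whose cardinals are known. *)
Definition coded f T Y (n : nat) (eta : R) := exists c : X -> T,
  forall x y, Y x -> Y y -> c x = c y -> forall i, (i < n)%N ->
    mdist (iter i f x) (iter i f y) <= eta.

Lemma card_separated_le f T Y n eta (E : {fset X}) :
  coded f T Y n eta -> [set` E] `<=` Y -> separated f n eta [set` E] ->
  (#|` E| <= #|T|)%N.
Proof.
move=> [c cP] EY Esep; rewrite cardfE.
apply: (@leq_card _ _ (fun e : E => c (val e))) => x y cxy; apply: contrapT => xy.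
have [||/val_inj //|i ni] := Esep (val x) (val y); do ?exact: valP.
by rewrite ltNge cP //; apply: EY; exact: valP.
Qed.

(** The code lists the labels at times [0, n, 2n, ...]; time [i] has offset [i %% n] in block
    [i %/ n]. *)
Lemma coded_iter f T n m t eta : (t <= m * n)%N ->
  coded f T setT n eta -> coded f {ffun 'I_m -> T} setT t eta.
Proof.
move=> tmn [c cP]; exists (fun x => [ffun j : 'I_m => c (iter (j * n) f x)]).
move=> x y _ _ /ffunP cxy i it; have imn := leq_trans it tmn.
have n0 : (0 < n)%N by case: n imn {tmn cP cxy} => //; rewrite muln0.
have im : (i %/ n < m)%N by rewrite ltn_divLR.
have := cxy (Ordinal im); rewrite !ffunE /= => /cP.
move=> /(_ I I (i %% n)%N); rewrite ltn_mod -!iterD.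
by rewrite [(i %% n + _)%N]addnC -divn_eq; exact.
Qed.

Lemma separated_fset1U f n eta (E : {fset X}) x :
  separated f n eta [set` E] ->
  (forall y, y \in E -> exists2 i, (i < n)%N &
     eta < mdist (iter i f x) (iter i f y)) ->
  separated f n eta [set` (x |` E)%fset].
Proof.
move=> Esep xE y z /= /fset1UP[->|yE] /fset1UP[->|zE] // yz.
- exact: xE.
- by have [i ni] := xE _ yE; rewrite metric_sym; exists i.
- exact: Esep.
Qed.

(** A separated set of maximal cardinality is spanning: each point is labelled by an element that
    stays [eta]-close to it, and equal labels give distance at most [2 * eta]. *)
Lemma coded_of_card_separated f n (eta r : R) : 0 <= eta ->
  (forall E : {fset X}, separated f n eta [set` E] -> #|` E|%:R <= r) ->
  exists2 T : finType, #|T|%:R <= r & coded f T setT n (2 * eta).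
Proof.
move=> eta0 Er.
pose P k := `[< exists2 E : {fset X}, separated f n eta [set` E] & #|` E| = k >].
have P0 : exists k, P k by exists 0%N; apply/asboolP; exists fset0.
have Pub k : P k -> (k <= Num.truncn r)%N.
  move=> /asboolP[E Esep <-].
  by rewrite truncn_ge_nat ?Er// (le_trans _ (Er _ Esep)).
case: (ex_maxnP P0 Pub) => k /asboolP[E Esep Ek] kmax.
exists E; first by rewrite -cardfE; exact: Er.
have close x : exists e : E, forall i, (i < n)%N ->
    mdist (iter i f (val e)) (iter i f x) <= eta.
  apply: contrapT => /forallNP H.
  have far y : y \in E -> exists2 i, (i < n)%N &
      eta < mdist (iter i f x) (iter i f y).
    move=> yE; have /existsNP[i /not_implyP[ni /negP]] := H [` yE]%fset.
    by rewrite -ltNge metric_sym; exists i.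
  have xE : x \notin E.
    by apply/negP => /far[i _]; rewrite mdistxx ltNge eta0.
  have /kmax : P #|` (x |` E)%fset|.
    by apply/asboolP; exists (x |` E)%fset => //; exact: separated_fset1U.
  by rewrite cardfsU1 xE Ek ltnn.
have [c cP] := choice close; exists c => x y _ _ cxy i ni.
rewrite mulr_natl mulr2n; apply: (@mdist_le_add _ _ (iter i f (val (c x)))).
  exact: cP.
by rewrite cxy; exact: cP.
Qed.

Lemma coded1_compact f (eta : R) : compact [set: X] -> 0 < eta ->
  exists T, coded f T setT 1 eta.
Proof.
move=> Xc eta0; have [|D HD] := @compact_finite_net _ X (eta / 2) Xc.
  by rewrite divr_gt0.
have close x : exists e : D, mdist (val e) x < eta / 2.
  by have [y yD] := HD x; exists [` yD]%fset.
have [c cP] := choice close; exists D, c => x y _ _ cxy i.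
rewrite ltnS leqn0 => /eqP -> /=; rewrite (splitr eta).
apply: (@mdist_le_add _ _ (val (c x))); first exact/ltW.
by rewrite cxy; exact/ltW.
Qed.

End codes.

(** * Estimates of entropy *)

Section entropy_bounds.
Context {R : realType} {X : metricType R}.
Implicit Types (f : X -> X) (Y : set X).

Lemma max_separated_le f Y n eta (r : R) :
  (forall E : {fset X}, [set` E] `<=` Y -> separated f n eta [set` E] ->
     #|` E|%:R <= r) -> (max_separated f Y n eta <= r%:E)%E.
Proof.
by move=> Er; apply: ge_ereal_sup => _ [E [EY Esep] <-]; rewrite lee_fin Er.
Qed.

Lemma max_separated_ge f Y n eta (E : {fset X}) : [set` E] `<=` Y ->
  separated f n eta [set` E] -> ((#|` E|%:R)%:E <= max_separated f Y n eta)%E.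
Proof. by move=> EY Esep; apply: ereal_sup_ubound; exists E. Qed.

Lemma max_separated_ge0 f Y n eta : (0 <= max_separated f Y n eta)%E.
Proof.
apply: le_trans (@max_separated_ge f Y n eta fset0 _ _).
- by rewrite cardfs0.
- by move=> x.
- by move=> x.
Qed.

Lemma rate_le (S : \bar R) n (a : R) : (0 < n)%N -> (0 <= S)%E ->
  (S <= (expR a)%:E)%E -> ((n%:R^-1)%:E * lne S <= (a / n%:R)%:E)%E.
Proof.
move=> n0 S0 Sa; rewrite mulrC EFinM lee_wpmul2l ?lee_fin ?invr_ge0//.
have -> : a%:E = lne (expeR a%:E) by rewrite expeRK.
by rewrite lee_lne ?in_itv/= ?S0 ?leey ?lee_fin ?expR_ge0.
Qed.

Lemma rate_ge (S : \bar R) n (a : R) : (0 < n)%N ->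
  ((expR a)%:E <= S)%E -> ((a / n%:R)%:E <= (n%:R^-1)%:E * lne S)%E.
Proof.
move=> n0 Sa; have S0 : (0 <= S)%E by rewrite (le_trans _ Sa)// lee_fin expR_ge0.
rewrite mulrC EFinM lee_wpmul2l ?lee_fin ?invr_ge0//.
have -> : a%:E = lne (expeR a%:E) by rewrite expeRK.
by rewrite lee_lne ?in_itv/= ?S0 ?leey ?lee_fin ?expR_ge0.
Qed.

Lemma growth_rate_le f Y eta (C a : R) :
  (forall t, (max_separated f Y t eta <= (expR (C + t%:R * a))%:E)%E) ->
  (limn_esup (fun n => (n%:R^-1)%:E * lne (max_separated f Y n eta)) <= a%:E)%E.
Proof.
move=> H; apply/lee_addgt0Pr => d d0.
(* Beyond this index [C / n] is below [d]. *)
apply: (@limn_esup_le _ _ _ (Num.truncn (C / d)).+1) => n Cn.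
have n0 : (0 < n)%N by apply: leq_trans Cn.
have n0' : (0 : R) < n%:R by rewrite ltr0n.
apply: le_trans (rate_le n0 (max_separated_ge0 _ _ _ _) (H n)) _.
rewrite -EFinD lee_fin ler_pdivrMr// mulrDl addrC mulrC lerD2l -ler_pdivrMl//.
rewrite mulrC; apply/ltW; apply: (lt_le_trans (truncnS_gt _)).
by rewrite ler_nat.
Qed.

(** An upper limit is bounded below along a subsequence, so the multiples of [L] suffice. *)
Lemma entropy_on_ge f Y (L : nat) (eta a : R) : (0 < L)%N -> 0 < eta ->
  (forall m, exists E : {fset X}, [/\ [set` E] `<=` Y,
     separated f (m * L) eta [set` E] & expR ((m * L)%:R * a) <= #|` E|%:R]) ->
  (a%:E <= entropy_on f Y)%E.
Proof.
move=> L0 eta0 H; apply: (@le_trans _ _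
  (limn_esup (fun n => (n%:R^-1)%:E * lne (max_separated f Y n eta)))%E); last first.
  by apply: ereal_sup_ubound; exists eta.
apply: limn_esup_ge => n0; exists (n0.+1 * L)%N.
  by rewrite (leq_trans (leqnSn n0))// leq_pmulr.
have mL : (0 < n0.+1 * L)%N by rewrite muln_gt0.
have [E [EY Esep aE]] := H n0.+1.
have -> : a = ((n0.+1 * L)%:R * a) / (n0.+1 * L)%:R.
  by rewrite mulrAC mulfV ?mul1r// pnatr_eq0 -lt0n.
apply: rate_ge => //; apply: le_trans (max_separated_ge EY Esep).
by rewrite lee_fin.
Qed.

(** The bound holds for every [n], not only for large ones: if it failed at a single [n], a small
    code for [n] steps would exist, and concatenating it would keep the growth rate at scale [eta]
    down to [a]. *)
Lemma top_entropy_separated f (a : R) : 0 <= a -> (a%:E < top_entropy f)%E ->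
  exists2 e0 : R, 0 < e0 & forall e, 0 < e -> e <= e0 ->
    forall n, (0 < n)%N -> exists2 E : {fset X}, separated f n e [set` E] &
      expR (n%:R * a) <= #|` E|%:R.
Proof.
move=> a0 /ereal_sup_gt[_ [eta /= eta0 <-] aeta].
exists (eta / 2); first by rewrite divr_gt0.
move=> e e_gt0 ee n n0; apply: contrapT => H.
have [||T Tn cT] := @coded_of_card_separated _ X f n e (expR (n%:R * a)).
- exact: ltW.
- by move=> E Esep; rewrite leNgt; apply/negP => /ltW aE; apply: H; exists E.
move: aeta; rewrite ltNge => /negP; apply.
(* The constant pays for the last, incomplete block of [n] steps. *)
apply: (@growth_rate_le _ _ _ (n%:R * a)) => t.
apply: max_separated_le => E EY Esep.
have tn : (t <= (t %/ n).+1 * n)%N by rewrite ltnW// ltn_ceil.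
have Esep2 : separated f t (2 * e) [set` E].
  move=> x y xE yE xy; have [i it ixy] := Esep x y xE yE xy; exists i => //.
  by apply: le_lt_trans ixy; lra.
have := card_separated_le (coded_iter tn cT) EY Esep2.
rewrite card_ffun card_ord -(ler_nat R) natrX => /le_trans; apply.
apply: (@le_trans _ _ (expR (n%:R * a) ^+ (t %/ n).+1)).
  by rewrite lerXn2r ?nnegrE ?ler0n ?expR_ge0.
rewrite -expRM_natl ler_expR -natr1 mulrDl mul1r addrC lerD2l mulrA.
by rewrite ler_wpM2r// -natrM ler_nat leq_divM.
Qed.

Lemma top_entropy_coded f (a eta : R) : 0 < eta -> (top_entropy f < a%:E)%E ->
  exists C : R, forall g, exists2 T : finType, coded f T setT g eta &
    #|T|%:R <= expR (C + g%:R * a).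
Proof.
move=> eta0 ha.
have [|n0 H] := @limn_esup_lt _
    (fun n => (n%:R^-1)%:E * lne (max_separated f setT n (eta / 2)))%E a%:E.
  apply: le_lt_trans ha; apply: ereal_sup_ubound; exists (eta / 2) => //=.
  by rewrite divr_gt0.
(* Coding [n0.+1 + g] steps brings every [g] past [n0], where the growth bound holds; the constant
   pays for the extra steps. *)
exists (n0.+1%:R * a) => g.
have [||T Tr [c cP]] := @coded_of_card_separated _ X f (n0.+1 + g) (eta / 2)
    (expR (n0.+1%:R * a + g%:R * a)).
- by rewrite divr_ge0// ltW.
- move=> E Esep; rewrite -mulrDl -natrD leNgt; apply/negP => aE.
  have n1 : (n0 <= n0.+1 + g)%N by rewrite addSn (leq_trans (leq_addr g n0)).
  have := H _ n1; rewrite ltNge => /negP; apply.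
  have -> : a = ((n0.+1 + g)%:R * a) / (n0.+1 + g)%:R.
    by rewrite mulrAC mulfV ?mul1r// pnatr_eq0.
  apply: rate_ge => //; apply: le_trans (max_separated_ge (subsetT _) Esep).
  by rewrite lee_fin ltW.
exists T => //; exists c => x y Yx Yy cxy i ig.
rewrite (_ : eta = 2 * (eta / 2)); last by rewrite mulrC divfK.
by apply: cP => //; rewrite (leq_trans ig)// leq_addl.
Qed.

(* Orbits that stay [e]-close for a bounded time start [eta]-close; hence the
   entropy of [f] on any set can be computed at the single scale [e]. *)
Definition determines_scale f (e : R) := forall eta : R, 0 < eta ->
  exists K : nat, forall x y,
    (forall i, (i < K)%N -> mdist (iter i f x) (iter i f y) <= e) ->
    mdist x y <= eta.

(** Otherwise there are pairs more than [eta] apart whose orbits stay [e0 / 2]-close for longer and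
    longer; a cluster point in [X * X] is a pair of distinct points that never get [e0] apart. *)
Lemma positively_expansive_determines f : compact [set: X] -> continuous f ->
  positively_expansive f -> exists2 e, 0 < e & determines_scale f e.
Proof.
move=> Xc fc [e0 e00 fe]; exists (e0 / 2); first by rewrite divr_gt0.
move=> eta eta0; apply: contrapT => /forallNP H.
have {}H K : exists p : X * X, (forall i, (i < K)%N ->
    mdist (iter i f p.1) (iter i f p.2) <= e0 / 2) /\ eta < mdist p.1 p.2.
  have /existsNP[x /existsNP[y /not_implyP[xy /negP]]] := H K.
  by rewrite -ltNge => ?; exists (x, y).
have [z zP] := choice H.
have XXc : compact [set: X * X].
  by rewrite -setXTT; exact: compact_setX.
have fic i : continuous (iter i f) by exact: continuous_iter.
have [p pP] := compact_seq_cluster z XXc.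
have p12 : p.1 <> p.2.
  move=> p12.
  (* If [p] were on the diagonal, [U] would be a neighbourhood of [p] missing every [z n]. *)
  pose U := [set q : X * X | mdist q.1 q.2 < eta].
  have UC : closed (~` U°) by apply: open_closedC; exact: open_interior.
  apply: (pP _ UC 0%N) => [n _ /interior_subset /=|].
    by have [_] := zP n; rewrite ltNge => /negP + /ltW.
  have e20 : 0 < eta / 2 by rewrite divr_gt0.
  exists ([set y | mdist p.1 y < eta / 2], [set y | mdist p.2 y < eta / 2]).
    by split; exact: nbhs_mdist_lt.
  move=> q [/= p1 p2]; rewrite /U /=.
  have := metric_triangle q.1 p.1 q.2.
  by rewrite (metric_sym q.1 p.1) {2}p12; lra.
have [i] := fe _ _ p12.
suff : mdist (iter i f p.1) (iter i f p.2) <= e0 / 2 by lra.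
pose A := [set q : X * X | mdist (iter i f q.1) (iter i f q.2) <= e0 / 2].
apply: (pP A _ i.+1) => [|n ni].
  apply: closed_mdist_le => q.
    exact: (continuous_comp (@cvg_fst _ _ _ _ _) (fic i _)).
  exact: (continuous_comp (@cvg_snd _ _ _ _ _) (fic i _)).
by apply: (zP n).1.
Qed.

(** A [(t, eta)]-separated set is [(K + t, e)]-separated, and the [K] extra steps only change the
    constant. *)
Lemma entropy_on_le f Y (e C a : R) : determines_scale f e ->
  (forall t (E : {fset X}), [set` E] `<=` Y -> separated f t e [set` E] ->
    #|` E|%:R <= expR (C + t%:R * a)) -> (entropy_on f Y <= a%:E)%E.
Proof.
move=> fe H; apply: ge_ereal_sup => _ [eta /= eta0 <-].
have [K KP] := fe _ eta0.
apply: (@growth_rate_le _ _ _ (C + K%:R * a)) => t.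
apply: max_separated_le => E EY Esep.
rewrite -addrA -mulrDl -natrD addnC; apply: H => // x y xE yE xy.
have [i it] := Esep x y xE yE xy; rewrite ltNge => /negP ixy.
apply: contrapT => far; apply: ixy; apply: KP => j jK.
rewrite leNgt -!iterD; apply/negP => ji; apply: far; exists (j + i)%N => //.
by lia.
Qed.

Lemma top_entropy_lty f : compact [set: X] -> continuous f ->
  positively_expansive f -> (top_entropy f < +oo)%E.
Proof.
move=> Xc fc /(positively_expansive_determines Xc fc)[e e0 fe].
have [T cT] := coded1_compact f Xc e0.
(* The crude bound [#|T|], in place of its logarithm, is enough for finiteness. *)
apply: (@le_lt_trans _ _ (#|T|%:R)%:E); last exact: ltry.
apply: (entropy_on_le (C := 0) fe) => t E EY Esep.
have := card_separated_le (@coded_iter _ X f T 1 t t e _ cT) EY Esep.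
rewrite muln1 leqnn card_ffun card_ord -(ler_nat R) natrX => /(_ isT)/le_trans.
apply; rewrite add0r expRM_natl lerXn2r ?nnegrE ?ler0n ?expR_ge0//.
by apply: le_trans (expR_ge1Dx _); rewrite lerDr.
Qed.

End entropy_bounds.

(** * The invariant sets of shadowing orbits *)

Section shadowing.
Context {R : realType} {X : metricType R}.
Implicit Types (f : X -> X) (E : {fset X}) (T : finType).

Definition block_shadowing f n L (e : R) E : set X := [set z | forall j,
  exists2 x, x \in E & forall i, (i < n)%N ->
    mdist (iter i f x) (iter (j * L + i) f z) <= e].

(** [block_shadowing] is only mapped into itself by [iter L f]; the union over the shifts [r < L]
    makes it [f]-invariant. *)
Definition orbit_shadowing f n L (e : R) E : set X :=
  \bigcup_(r in `I_L) (iter r f @` block_shadowing f n L e E).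

Lemma closed_block_shadowing f n L e E : continuous f ->
  closed (block_shadowing f n L e E).
Proof.
move=> fc.
have -> : block_shadowing f n L e E = \bigcap_(j in [set: nat])
    \bigcup_(x in [set` E]) \bigcap_(i in `I_n)
      [set z | mdist (iter i f x) (iter (j * L + i) f z) <= e].
  apply/seteqP; split=> z.
    by move=> Zz j _; have [x xE xz] := Zz j; exists x.
  by move=> Zz j; have [x xE xz] := Zz j I; exists x.
apply: closed_bigI => j _; apply: closed_bigcup; first exact: finite_fset.
move=> x _; apply: closed_bigI => i _; apply: closed_mdist_le => z.
  exact: cvg_cst.
exact: continuous_iter.
Qed.

Lemma closed_orbit_shadowing f n L e E : compact [set: X] -> continuous f ->
  closed (orbit_shadowing f n L e E).
Proof.
move=> Xc fc; apply: closed_bigcup => [|r _]; first exact: finite_II.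
apply: compact_closed; first exact: metric_hausdorff.
apply: continuous_compact.
  by apply: continuous_subspaceT; exact: continuous_iter.
apply: (subclosed_compact _ Xc) => //; exact: closed_block_shadowing.
Qed.

Lemma invariant_orbit_shadowing f n L e E :
  invariant_set f (orbit_shadowing f n L e E).
Proof.
move=> _ [_ [r rL [z Zz <-]] <-]; have [rL1|Lr] := ltnP r.+1 L.
  by exists r.+1 => //; exists z.
(* At the last shift [r = L - 1] one more step completes a window, and the shift restarts at 0 with
   the windows renumbered. *)
have -> : f (iter r f z) = iter 0 f (iter L f z).
  by rewrite (_ : L = r.+1)//; apply/eqP; rewrite eqn_leq Lr.
exists 0%N; first exact: leq_ltn_trans rL.
exists (iter L f z) => // j; have [x xE xz] := Zz j.+1.
exists x => // i ni; rewrite -iterD addnAC -mulSnr; exact: xz.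
Qed.

(* The gap tracing property only shadows finitely many orbit segments;
   compactness handles infinitely many. *)
Lemma gap_tracing_seq f M n (e : R) (w : nat -> X) : compact [set: X] ->
  continuous f -> gap_tracing f M -> (0 < n)%N -> 0 < e ->
  exists z, forall j i, (i < n)%N ->
    mdist (iter i f (w j)) (iter (j * (n + M n e) + i) f z) <= e.
Proof.
move=> Xc fc fM n0 e0; set L := (n + M n e)%N.
have fin k : exists z, forall j i, (j < k.+2)%N -> (i < n)%N ->
    mdist (iter i f (w j)) (iter (j * L + i) f z) <= e.
  (* The segments occupy the times from [j * L] to [j * L + n - 1], so consecutive ones differ by
     [M n e + 1]. Using [k.+2] of them meets the requirement of at least two. *)
  have [|||z zP] := fM e k.+2 w (fun j => j * L)%N (fun j => j * L + n.-1)%N e0 isT.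
  - by move=> i _; rewrite leq_addr.
  - by move=> i _; rewrite mulSn addnC ltn_add2r /L; lia.
  - move=> i _; rewrite addKn (_ : n.-1 + 1 = n)%N; last by lia.
    by rewrite mulSn /L; lia.
  exists z => j i jk ni; have := zP j (j * L + i)%N jk.
  by rewrite addKn; apply; lia.
have [z zP] := choice fin.
have [p pP] := compact_seq_cluster z Xc.
exists p => j i ni.
pose A := [set q | mdist (iter i f (w j)) (iter (j * L + i) f q) <= e].
apply: (pP A _ j) => [|k jk]; last by apply: zP => //; lia.
by apply: closed_mdist_le => q; [exact: cvg_cst|exact: continuous_iter].
Qed.

(** Every word of length [m] over [E] is traced by an orbit. Two words differ in some block, where
    points more than [3 * e] apart are each traced within [e], so that the orbits get more than [e]
    apart. *)
Lemma orbit_shadowing_separated f M n (e : R) E m : compact [set: X] ->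
  continuous f -> gap_tracing f M -> (0 < n)%N -> 0 < e ->
  separated f n (3 * e) [set` E] -> (0 < #|` E|)%N ->
  exists E' : {fset X},
    [/\ [set` E'] `<=` orbit_shadowing f n (n + M n e) e E,
        separated f (m * (n + M n e)) e [set` E'] &
        (#|` E| ^ m)%N = #|` E'|].
Proof.
move=> Xc fc fM n0 e0 Esep; rewrite cardfs_gt0 => /fset0Pn[x0 x0E].
set L := (n + M n e)%N.
(* Membership in [block_shadowing] concerns all windows, so words are continued by [x0] after
   position [m]. *)
have tr (w : {ffun 'I_m -> E}) : exists z, forall j i, (i < n)%N ->
    mdist (iter i f (oapp (fun j => val (w j)) x0 (insub j)))
      (iter (j * L + i) f z) <= e.
  exact: gap_tracing_seq.
have [z zP] := choice tr.
have zsep w w' : w <> w' -> exists2 i, (i < m * L)%N &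
    e < mdist (iter i f (z w)) (iter i f (z w')).
  move=> ww'; have [j jw] : exists j, w j <> w' j.
    apply: contrapT => /forallNP H; apply: ww'; apply/ffunP => j.
    exact: contrapT (H j).
  have [||/val_inj //|i ni wi] := Esep (val (w j)) (val (w' j)); do ?exact: valP.
  exists (j * L + i)%N.
    by have := ltn_ord j; rewrite /L; nia.
  have := zP w j i ni; have := zP w' j i ni; rewrite valK /=.
  set a := iter i f (val (w j)) in wi *; set b := iter i f _ in wi *.
  set p := iter _ f (z w); set q := iter _ f (z w') => bq ap.
  have := metric_triangle a p b; have := metric_triangle p q b.
  by rewrite (metric_sym q b); lra.
exists [fset z w | w : {ffun 'I_m -> E}]%fset; split.
- move=> _ /= /imfsetP[w _ ->]; exists 0%N => /=; first by rewrite /L addn_gt0 n0.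
  exists (z w) => // j; exists (oapp (fun j => val (w j)) x0 (insub j)).
    by case: insub => //= k; exact: valP.
  exact: zP.
- by move=> _ _ /= /imfsetP[w _ ->] /imfsetP[w' _ ->] ww'; apply: zsep => ?; subst.
- rewrite card_imfset /=; first by rewrite -cardE card_ffun card_ord cardfE.
  move=> w w' zw; apply: contrapT => /zsep[i _].
  by rewrite zw mdistxx; lra.
Qed.

(** The code records the shift, the point of [E] shadowed in each window, and the label in [T] of
    the orbit at the start of each gap. The summand [n + g] on the left leaves room for the
    shift. *)
Lemma coded_orbit_shadowing f n g (e eta : R) E T m t : 2 * e <= eta ->
  (0 < n)%N -> (0 < #|` E|)%N -> (t + (n + g) <= m * (n + g))%N ->
  coded f T setT g eta ->
  coded f ('I_(n + g) * ({ffun 'I_m -> E} * {ffun 'I_m -> T}))%type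
    (orbit_shadowing f n (n + g) e E) t eta.
Proof.
move=> e2 n0 + + [cT cTP]; rewrite cardfs_gt0 => /fset0Pn[x0 x0E].
set L := (n + g)%N => tL.
have L0 : (0 < L)%N by rewrite addn_gt0 n0.
set Code := ('I_L * _)%type.
have code y : exists c : Code, orbit_shadowing f n L e E y -> exists z,
    y = iter c.1 f z /\ forall j : 'I_m,
    (forall i, (i < n)%N ->
      mdist (iter i f (val (c.2.1 j))) (iter (j * L + i) f z) <= e) /\
    c.2.2 j = cT (iter (j * L + n) f z).
  have [[r rL [z Zz zy]]|Yy] := pselect (orbit_shadowing f n L e E y); last first.
    by exists (Ordinal L0, ([ffun _ => [` x0E]%fset], [ffun _ => cT y])).
  have block j : exists x : E, forall i, (i < n)%N ->
      mdist (iter i f (val x)) (iter (j * L + i) f z) <= e.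
    by have [x xE xz] := Zz j; exists [` xE]%fset.
  have [w wP] := choice block.
  exists (Ordinal rL, ([ffun j : 'I_m => w j],
    [ffun j : 'I_m => cT (iter (j * L + n) f z)])) => _; exists z.
  by split=> // j; rewrite !ffunE; split=> // i ni; exact: wP.
have [c cP] := choice code; exists c => y y' /cP + /cP + cc.
rewrite cc; case: (c y') => r [w h] /= [z [-> zP]] [z' [-> z'P]] i it.
rewrite -!iterD.
have iL : (i + r < m * L)%N by have := ltn_ord r; lia.
have jm : ((i + r) %/ L < m)%N by rewrite ltn_divLR.
have [zw zh] := zP (Ordinal jm); have [z'w z'h] := z'P (Ordinal jm).
rewrite /= in zw zh z'w z'h; rewrite (divn_eq (i + r) L).
set j := ((i + r) %/ L)%N in zw zh z'w z'h *; set s := (_ %% L)%N.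
have sL : (s < L)%N by rewrite ltn_mod.
have [sn|ns] := ltnP s n.
  apply: le_trans e2; rewrite mulr_natl mulr2n.
  by apply: (mdist_le_add (zw _ sn) (z'w _ sn)).
rewrite -(subnKC ns) addnA [(_ + (s - n))%N]addnC ![iter (s - n + _) f _]iterD.
by apply: cTP => //; [rewrite -zh -z'h|rewrite /L in sL; lia].
Qed.

End shadowing.

(** * Choice of the constants and proof of the theorem *)

Lemma fsubset_of_card (K : choiceType) (A : {fset K}) k : (k <= #|` A|)%N ->
  exists2 B : {fset K}, (B `<=` A)%fset & #|` B| = k.
Proof.
move=> kA; exists [fset x in take k A]%fset.
  by apply/fsubsetP => x; rewrite inE /= => /mem_take.
rewrite -[RHS](size_takel kA); apply/perm_size/uniq_perm.
- exact: fset_uniq.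
- by rewrite take_uniq// fset_uniq.
- by move=> x; rewrite inE.
Qed.

(** For [d = s = 0] both inequalities are strict: the first is [T * h < beta * (1 + T)] rearranged,
    and then [gamma * (1 + T) <= (h - beta) * (1 + T) < h]. *)
Lemma slack_exists (R : realFieldType) (T h gamma beta : R) :
  0 <= T -> 0 <= gamma -> gamma + beta < h -> T * h < beta * (1 + T) ->
  exists d s, [/\ 0 < d, 0 < s, (T + d) * (h + d - beta) + s <= beta &
    gamma * (1 + T + d) + s <= h - d].
Proof.
move=> T0 g0 gbh Th.
pose A := beta * (1 + T) - T * h; pose B := h - gamma * (1 + T).
have A0 : 0 < A by rewrite subr_gt0.
have B0 : 0 < B by rewrite /B; nra.
(* As [d <= 1], passing from 0 to [d] costs at most [d * P] in the first inequality and
   [d * (gamma + 1)] in the second; each may use half of its slack, [s] the other half. *)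
pose P := T + h - beta + 1; have P0 : 0 < P by rewrite /P; lra.
pose d := Num.min 1 (Num.min (A / (2 * P)) (B / (2 * (gamma + 1)))).
have d1 : d <= 1 by rewrite /d ge_min lexx.
have dA : d * (2 * P) <= A.
  rewrite -ler_pdivlMr ?mulr_gt0//.
  by rewrite /d !ge_min lexx ?orbT.
have dB : d * (2 * (gamma + 1)) <= B.
  rewrite -ler_pdivlMr ?mulr_gt0 ?ltr_wpDl//.
  by rewrite /d !ge_min lexx !orbT.
have d0 : 0 < d.
  by rewrite !lt_min ltr01 !divr_gt0// ?mulr_gt0// ltr_wpDl.
exists d, (Num.min (A / 2) (B / 2)).
have sA : Num.min (A / 2) (B / 2) <= A / 2 by rewrite ge_min lexx.
have sB : Num.min (A / 2) (B / 2) <= B / 2 by rewrite ge_min lexx orbT.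
split=> //; first by rewrite lt_min !divr_gt0.
  by rewrite /A /P in dA sA *; nra.
by rewrite /B in dB sB *; nra.
Qed.

Lemma gap_rate_ge0 (R : realType) (M : nat -> R -> nat) : (0 <= gap_rate M)%E.
Proof.
apply: (@le_trans _ _ (limn_einf (fun n => ((M n 1)%:R / n%:R : R)%:E))).
  rewrite leNgt; apply/negP => /limn_einf_lt /(_ 0%N)[n _].
  by rewrite ltNge lee_fin divr_ge0.
by apply: ereal_sup_ubound; exists 1 => //=.
Qed.

Lemma gap_rate_lt (R : realType) (M : nat -> R -> nat) (e a : R) :
  0 < e -> (gap_rate M < a%:E)%E ->
  forall n0, exists n, [/\ (n0 <= n)%N, (0 < n)%N & (M n e)%:R <= a * n%:R].
Proof.
move=> e0 Ma n0; have ea : (limn_einf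
    (fun n => ((M n e)%:R / n%:R : R)%:E) < a%:E)%E.
  by apply: le_lt_trans Ma; apply: ereal_sup_ubound; exists e.
have [n n0n] := limn_einf_lt ea n0.+1; rewrite lte_fin => na.
have n1 : (0 < n)%N by apply: leq_trans n0n.
exists n; split=> //; first exact: ltnW.
by rewrite -ler_pdivrMr ?ltr0n// ltW.
Qed.

Lemma entropy_on_orbit_shadowing_le (R : realType) (X : metricType R)
    (f : X -> X) n g (e e1 a c : R) (E : {fset X}) (T : finType) :
  determines_scale f e1 -> 2 * e <= e1 -> (0 < n)%N -> (0 < #|` E|)%N ->
  coded f T setT g e1 -> 0 <= a -> 0 <= c ->
  #|` E|%:R <= expR a -> #|T|%:R <= expR c ->
  (entropy_on f (orbit_shadowing f n (n + g) e E) <= ((a + c) / (n + g)%:R)%:E)%E.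
Proof.
move=> fe1 e2 n0 E0 cT a0 c0 Ea Tc; set L := (n + g)%N.
have L0 : (0 < L)%N by rewrite addn_gt0 n0.
have L0' : (0 : R) < L%:R by rewrite ltr0n.
(* [L%:R] bounds the logarithm of the number of shifts; [2 * (a + c)] pays for two windows beyond
   [t / L], one for rounding and one for the shift. *)
apply: (@entropy_on_le _ _ _ _ e1 (L%:R + 2 * (a + c))) => // t E' E'Y E'sep.
have [m tL mL] : exists2 m, (t + L <= m * L)%N & (m * L <= t + 2 * L)%N.
  exists (t %/ L).+2; first by rewrite mulSn addnC leq_add2l ltnW// ltn_ceil.
  by rewrite -addn2 mulnDl leq_add2r leq_divM.
have := card_separated_le (coded_orbit_shadowing e2 n0 E0 tL cT) E'Y E'sep.
rewrite !card_prod !card_ffun !card_ord -cardfE -(ler_nat R) => /le_trans; apply.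
rewrite natrM natrM !natrX -exprMn -!addrA expRD ler_pM ?ler0n//.
  by apply: le_trans (expR_ge1Dx _); rewrite lerDr.
apply: (@le_trans _ _ (expR (a + c) ^+ m)).
  by rewrite lerXn2r ?nnegrE ?mulr_ge0 ?expR_ge0// expRD ler_pM.
rewrite -expRM_natl ler_expR (_ : 2 * _ + _ = (t + 2 * L)%:R * ((a + c) / L%:R)).
  rewrite mulrCA [leLHS]mulrC ler_wpM2l ?addr_ge0// ler_pdivlMr//.
  by rewrite -natrM ler_nat.
by rewrite natrD natrM; field; rewrite gt_eqF.
Qed.

Lemma entropy_on_orbit_shadowing_ge (R : realType) (X : metricType R)
    (f : X -> X) M n (e : R) (E : {fset X}) :
  compact [set: X] -> continuous f -> gap_tracing f M -> (0 < n)%N -> 0 < e ->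
  separated f n (3 * e) [set` E] -> (0 < #|` E|)%N ->
  ((ln #|` E|%:R / (n + M n e)%:R)%:E <=
   entropy_on f (orbit_shadowing f n (n + M n e) e E))%E.
Proof.
move=> Xc fc fM n0 e0 Esep E0; set L := (n + M n e)%N.
have L0 : (0 < L)%N by rewrite addn_gt0 n0.
apply: (@entropy_on_ge _ _ _ _ L e) => // m.
have [E' [E'Y E'sep E'E]] := orbit_shadowing_separated m Xc fc fM n0 e0 Esep E0.
exists E'; split=> //; rewrite -E'E natrM -mulrA [X in _ * X]mulrCA mulfV.
  by rewrite mulr1 expRM_natl lnK ?posrE ?ltr0n// natrX.
by rewrite pnatr_eq0 -lt0n.
Qed.

Theorem theorem13 (R : realType) (X : metricType R) (f : X -> X)
    (tau : \bar R) (X_compact : compact [set: X])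
    (X_two_points : exists x y : X, x <> y) (f_continuous : continuous f)
    (f_spec : nonuniform_specification f tau)
    (f_expansive : positively_expansive f) (tau_fin : (tau < +oo)%E)
    (gamma beta : R) :
  0 <= gamma -> (gamma%:E < top_entropy f)%E ->
  (tau / (1 + tau) * top_entropy f < beta%:E)%E ->
  (beta%:E < top_entropy f - gamma%:E)%E ->
  exists Y : set X,
    [/\ closed Y, invariant_set f Y,
        (gamma%:E < entropy_on f Y)%E &
        (entropy_on f Y < (gamma + beta)%:E)%E].
Proof.
move=> gamma0 gamma_h tau_beta beta_h.
have [[M [_ fM] Mtau] _] := f_spec.
have h_fin := top_entropy_lty X_compact f_continuous f_expansive.
have := gap_rate_ge0 M; rewrite Mtau.
case: tau tau_fin Mtau tau_beta {f_spec} => [T| |] // _ MT.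
case hE : (top_entropy f) gamma_h beta_h h_fin => [h| |] //.
rewrite lte_fin => gamma_h + _ + T0; rewrite lee_fin in T0.
have T10 : 0 < 1 + T by rewrite ltr_pwDl.
rewrite lte_fin ltrBrDl => beta_h.
rewrite -EFinD inver gt_eqF// -!EFinM lte_fin mulrAC ltr_pdivrMr// => Th.
have [d [s [d0 s0 ds_upper ds_lower]]] := slack_exists T0 gamma0 beta_h Th.
have [e1 e10 fe1] :=
  positively_expansive_determines X_compact f_continuous f_expansive.
have [||e0 e00 fe0] := @top_entropy_separated _ _ f (h - d).
- by nra.
- by rewrite hE lte_fin; lra.
have [|C CP] := @top_entropy_coded _ _ f (h + d) e1 e10.
  by rewrite hE lte_fin; lra.
(* The first bound gives large sets separated at scale [3 * e]; the second lets shadowing within [e]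
   be read at scale [e1]. *)
pose e := Num.min (e0 / 3) (e1 / 2).
have e_gt0 : 0 < e by rewrite lt_min !divr_gt0.
have e3 : 3 * e <= e0.
  by have : e <= e0 / 3; [rewrite ge_min lexx|lra].
have e2 : 2 * e <= e1.
  by have : e <= e1 / 2; [rewrite ge_min lexx orbT|lra].
(* [n] is also taken so large that [s * n] absorbs [1 + |C|]. *)
have [|n [n0 n1 Mn]] := @gap_rate_lt _ M e (T + d) e_gt0 _
    (Num.truncn ((1 + `|C|) / s)).+1.
  by rewrite MT lte_fin; lra.
set g := M n e in Mn; pose L := (n + g)%N.
have LE : L%:R = n%:R + g%:R :> R by rewrite natrD.
have sn : 1 + `|C| < s * n%:R.
  rewrite -ltr_pdivrMl// mulrC; apply: (lt_le_trans (truncnS_gt _)).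
  by rewrite ler_nat.
have L0 : (0 : R) < L%:R by rewrite ltr0n addn_gt0 n1.
have C0 := normr_ge0 C.
(* The least integer above [exp(gamma * L)]: the lower bound on entropy becomes strict, and rounding
   costs at most a factor [exp(1)]. *)
pose N := (Num.truncn (expR (gamma * L%:R))).+1.
have N_gt : expR (gamma * L%:R) < N%:R by exact: truncnS_gt.
have N_le : N%:R <= expR (gamma * L%:R + 1).
  rewrite -natr1 expRD; apply: (@le_trans _ _
    (expR (gamma * L%:R) + expR (gamma * L%:R))).
    apply: lerD; first by rewrite truncn_le expR_ge0.
    by rewrite -expR0 ler_expR mulr_ge0// ltW.
  rewrite -mulr2n -[leLHS]mulr_natr ler_wpM2l ?expR_ge0//.
  by apply: le_trans (expR_ge1Dx _); rewrite -natr1.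
have [|E0 E0sep E0card] := fe0 (3 * e) _ e3 n n1; first by rewrite mulr_gt0.
(* [E0] is large enough: [gamma * L + 1 <= n * (h - d)] by [ds_lower], since [L <= (1 + T + d) * n]
   and [1 <= s * n]. *)
have [|E EE0 EN] := @fsubset_of_card _ E0 N.
  rewrite -(ler_nat R); apply: le_trans N_le (le_trans _ E0card).
  have := ler_wpM2l gamma0 Mn; have := ler_wpM2r (ler0n R n) ds_lower.
  by rewrite ler_expR LE; lra.
have Esep : separated f n (3 * e) [set` E].
  by move=> x y xE yE; apply: E0sep; exact: (fsubsetP EE0).
have [K cK Kcard] := CP g.
have E_gt0 : (0 < #|` E|)%N by rewrite EN.
exists (orbit_shadowing f n L e E); split.
- exact: closed_orbit_shadowing.
- exact: invariant_orbit_shadowing.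
- apply: lt_le_trans (entropy_on_orbit_shadowing_ge X_compact f_continuous fM n1
    e_gt0 Esep E_gt0).
  rewrite lte_fin EN ltr_pdivlMr// -ltr_expR lnK//.
  by rewrite posrE ltr0n.
- apply: (@le_lt_trans _ _
    ((gamma * L%:R + 1 + (`|C| + g%:R * (h + d))) / L%:R)%:E); last first.
    rewrite lte_fin ltr_pdivrMr//.
    (* After cancelling [gamma * L] and moving [beta * g] to the left, the claim is
       [1 + |C| + g * (h + d - beta) < beta * n], which follows from [g <= (T + d) * n] and
       [ds_upper]. *)
    have hb : 0 <= h + d - beta by lra.
    have := ler_wpM2r hb Mn; have := ler_wpM2r (ler0n R n) ds_upper.
    by rewrite LE; lra.
  apply: (@entropy_on_orbit_shadowing_le _ _ _ _ _ _ _ _ _ _ K fe1 e2) => //.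
  + by rewrite addr_ge0// mulr_ge0// ltW.
  + by rewrite addr_ge0// mulr_ge0//; lra.
  + by rewrite EN.
  + apply: le_trans Kcard _; rewrite ler_expR lerD2r; exact: ler_norm.
Qed.
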